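(* Let $k\in\mathbb{N}$ and let $\mathcal{C}^k = (C^k_1, \ldots, C^k_{2k})$ be a COCOA for $L^k \cap \hat L^k$. For $1\le i\le 2k$, a minimal deterministic co-Büchi automaton for $\mathcal{L}(C^k_i)$ has at most $2^{2k} \cdot k$ many states. For even $k$, the history-deterministic co-Büchi automaton $C^k_k$ has at least $2^{k}$ many states. For odd $k$, $C^k_{k-1}$ has at least $2^{k-2}$ many states.
   Context: The languages. Let $\Sigma = \{X_1, \ldots, X_k, Y_1, \ldots, Y_k, a_0, \ldots, a_{4k-1}\}$. For $1\le i\le k$ let (as $\omega$-regular expressions) $$L^k_i = ((\Sigma \setminus \{ X_i \}) + X_i (\Sigma \setminus \{ X_i \})^* X_i )^* (a_0 + \ldots + a_{4k-2i+1} )^\omega + \Sigma^* (a_0 + \ldots + a_{4k-2i} )^\omega,$$ $$\hat L^k_i = ((\Sigma \setminus \{ Y_i \}) + Y_i (\Sigma \setminus \{ Y_i \})^* Y_i )^* (a_{2i-2} + \ldots + a_{4k-1} )^\omega + \Sigma^* (a_{2i-1} + \ldots + a_{4k-1} )^\omega.$$ For a falling chain of languages $L_1\supset\cdots\supset L_n$, $\mathcal{L}(L_1,\ldots,L_n)$ is the set of words $w$ such that $w\notin L_1$ or the highest $i$ with $w\in L_i$ is even. Set $L^k=\mathcal{L}(L^k_1,\ldots,L^k_k)$ and $\hat L^k=\mathcal{L}(\hat L^k_1,\ldots,\hat L^k_k)$. By convention, the element of index $0$ of a COCOA has the universal language $\Sigma^\omega$. Automata. A co-Büchi automaton with transition-based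 acceptance is $(Q,\Sigma,\delta,q_0)$ with finite $Q$, input-complete $\delta\subseteq Q\times\Sigma\times Q\times\{1,2\}$, the color in $\{1,2\}$ of a transition depending only on its source state and letter; a run is accepting if the lowest color occurring infinitely often is $2$, and a word is accepted if it has an accepting run. All co-Büchi automata here have transition-based acceptance. It is deterministic if for each $(q,x)$ there is exactly one $(q',c)$ with $(q,x,q',c)\in\delta$. It is history-deterministic if its nondeterminism can be resolved letter by letter by an advice function of the finite prefix read so far, such that for every accepted word the resulting run is accepting. Natural colors. Here $\mathbb{N}$ contains $0$. Fix an $\omega$-regular language $L$ and write $L|_u=\{w'\in\Sigma^\omega\mid uw'\in L\}$. For $w = w_0w_1\ldots \in \Sigma^\omega$, the word $w_0\ldots w_i \tilde w w_{i+1} w_{i+2}\ldots$ results from a residual language invariant injection of $\tilde w\in\Sigma^*$ at position $i$ if $L|_{w_0\ldots w_i} = L|_{w_0\ldots w_i\tilde w}$. A word $w$ is at home in a color of $i \in \mathbb{N}$ if there exists an (infinite) sequence of injection points $J \subset \mathbb{N}$ such that for all words $w'$ that result from injecting residual language invariant words at word positions in $J$ into $w$, either $w'$ is at home in a color strictly smaller than $i$, or both $w,w' \in L$ and $i$ is even, or both $w,w' \notin L$ and $i$ is odd (for $i=0$ only the latter kind of condition can apply). The natural color of $w$ (w.r.t. $L$) is the minimal color in which $w$ is at home. COCOA. A chain of co-Büchi automata (COCOA) for $L$ is a sequence $(A_1,\ldots,A_n)$ of history-deterministic co-Büchi automata with transition-based acceptance with $\mathcal{L}(A_1)\supset\cdots\supset\mathcal{L}(A_n)$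 such that $A_1$ rejects exactly the words of natural color $0$ w.r.t. $L$ and, for each $1\le i\le n$, the words accepted by $A_i$ but rejected by $A_{i+1}$ (if $i<n$) are exactly those of natural color $i$ w.r.t. $L$.
   Formalization: The upper bound 2^{2k}·k on minimal deterministic automata is stated only for k ≠ 1: for k = 1 it fails, since a deterministic co-Büchi automaton for the language of C^1_1 needs at least 5 > 4 states. The lower bounds are stated for all k. *)

(* Defs.v *)
From mathcomp Require Import all_boot all_order all_algebra.

Set Implicit Arguments.
Unset Strict Implicit.
Unset Printing Implicit Defensive.

Definition infinitely_often (P : nat -> Prop) : Prop :=
  forall n, exists2 m, n <= m & P m.

Section OmegaWords.
Variable A : finType.

Definition word := nat -> A.
Definition lang := seq A -> Prop.
Definition olang := word -> Prop.

Implicit Types (u : seq A) (w : word) (U V : lang) (K L : olang).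

Definition prefix_of w n : seq A := mkseq w n.

Definition wcat u w : word :=
  foldr (fun a (w' : word) n => if n is m.+1 then w' m else a) w u.

(* [w] is the infinite concatenation [u 0 ++ u 1 ++ u 2 ++ ...].  This determines
   [w] only when infinitely many blocks are nonempty; it is used below with
   nonempty blocks only. *)
Definition is_inf_concat (u : nat -> seq A) w : Prop :=
  forall n, let p := flatten (mkseq u n) in prefix_of w (size p) = p.

Definition oeq K L : Prop := forall w, K w <-> L w.
Definition osubset K L : Prop := forall w, K w -> L w.
Definition oproper K L : Prop := osubset K L /\ ~ osubset L K.
Definition ointer K L : olang := fun w => K w /\ L w.
Definition ounion K L : olang := fun w => K w \/ L w.

(* Omega-regular expressions *)
Definition letters (P : pred A) : lang := fun u => exists2 a, P a & u = [:: a].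
Definition lunion U V : lang := fun u => U u \/ V u.
Definition lcat U V : lang := fun u => exists u1 u2, [/\ U u1, V u2 & u = u1 ++ u2].
Definition lstar U : lang :=
  fun u => exists2 us : seq (seq A), {in us, forall v, U v} & u = flatten us.
Definition lomega U : olang :=
  fun w => exists2 us : nat -> seq A,
    (forall n, U (us n) /\ us n <> [::]) & is_inf_concat us w.
Definition locat U K : olang :=
  fun w => exists u w', [/\ U u, K w' & w =1 wcat u w'].

(* The language of the chain [Ls 1, ..., Ls n]. *)
Definition chain_olang (n : nat) (Ls : nat -> olang) : olang := fun w =>
  ~ Ls 1 w \/
  exists i, [/\ 1 <= i <= n, Ls i w, (forall j, i < j <= n -> ~ Ls j w) & ~~ odd i].

Definition residual L u : olang := fun w => L (wcat u w).

(* [w'] is [w 0, v 0, w 1, v 1, ...], where the word [v i] injected after the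
   letter [w i] is empty for [i] outside [J]. *)
Definition injection_result L (J : nat -> Prop) w w' : Prop :=
  exists v : nat -> seq A,
    [/\ forall i, ~ J i -> v i = [::],
        forall i, J i ->
          oeq (residual L (prefix_of w i.+1)) (residual L (prefix_of w i.+1 ++ v i))
      & is_inf_concat (fun i => w i :: v i) w'].

Inductive at_home L : nat -> word -> Prop :=
  AtHome i w (J : nat -> Prop) of
    infinitely_often J &
    (forall w', injection_result L J w w' ->
       [\/ exists2 j, j < i & at_home L j w',
           [/\ L w, L w' & ~~ odd i]
         | [/\ ~ L w, ~ L w' & odd i]]) :
    at_home L i w.

Definition natural_color L w (i : nat) : Prop :=
  at_home L i w /\ forall j, at_home L j w -> i <= j.

Record cobuchi := Cobuchi {
  state : finType;
  init : state;
  (* [delta q x q' c] : transition from [q] to [q'] on [x] with color [c] *)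
  delta : state -> A -> state -> nat -> bool;
  delta_color : forall q x q' c, delta q x q' c -> (c == 1) || (c == 2);
  delta_complete : forall q x, exists q' c, delta q x q' c;
  delta_color_uniq : forall q x q1 c1 q2 c2,
    delta q x q1 c1 -> delta q x q2 c2 -> c1 = c2
}.

Implicit Types B D : cobuchi.

Definition is_run B w (r : nat -> state B) (c : nat -> nat) : Prop :=
  r 0 = init B /\ forall n, delta (r n) (w n) (r n.+1) (c n).

Definition accepting_colors (c : nat -> nat) : Prop :=
  infinitely_often (fun n => c n = 2) /\
  forall d, d < 2 -> ~ infinitely_often (fun n => c n = d).

Definition accepted B : olang := fun w =>
  exists r c, is_run (B := B) w r c /\ accepting_colors c.

Definition deterministic B : Prop :=
  forall (q : state B) x, exists! p : state B * nat, delta q x p.1 p.2.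

(* The advice [f u] is the state of the resolved run after reading [u]. *)
Definition history_deterministic B : Prop :=
  exists f : seq A -> state B,
    [/\ f [::] = init B,
        forall u x, exists c, delta (f u) x (f (rcons u x)) c
      & forall w, accepted B w ->
          exists2 c, is_run w (fun n => f (prefix_of w n)) c & accepting_colors c].

Definition nb_states B : nat := #|state B|.

Definition minimal_deterministic L D : Prop :=
  [/\ deterministic D, oeq (accepted D) L
    & forall D', deterministic D' -> oeq (accepted D') L -> nb_states D <= nb_states D'].

(* [C 1, ..., C n] is a COCOA for [L]; [C 0] is the element of index 0, universal
   by convention, and [C i] is irrelevant for [n < i].  With [C 0] universal, the
   case [i = 0] of the last clause says that [C 1] rejects exactly the words of
   natural color 0. *)
Definition is_cocoa L (n : nat) (C : nat -> cobuchi) : Prop :=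
  [/\ forall w, accepted (C 0) w,
      forall i, 1 <= i <= n -> history_deterministic (C i),
      forall i, 1 <= i < n -> oproper (accepted (C i.+1)) (accepted (C i))
    & forall i w, i <= n ->
        (accepted (C i) w /\ (i < n -> ~ accepted (C i.+1) w)) <-> natural_color L w i].

End OmegaWords.

(* [X_1, ..., X_k], [Y_1, ..., Y_k] and [a_0, ..., a_(4k-1)]; the letter [X_i]
   (resp. [Y_i]) is encoded by the ordinal of value [i - 1]. *)
Definition alphabet (k : nat) : finType := ('I_k + 'I_k + 'I_(4 * k))%type.

Section Languages.
Variable k : nat.

Definition isX (i : nat) : pred (alphabet k) :=
  fun x => if x is inl (inl j) then j.+1 == i else false.
Definition isY (i : nat) : pred (alphabet k) :=
  fun x => if x is inl (inr j) then j.+1 == i else false.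
(* [a_lo, ..., a_hi] *)
Definition isa (lo hi : nat) : pred (alphabet k) :=
  fun x => if x is inr j then lo <= j <= hi else false.

(* ((Sigma \ {x}) + x (Sigma \ {x})^* x)^* for the letter x described by P *)
Definition even_expr (P : pred (alphabet k)) : lang (alphabet k) :=
  lstar (lunion (letters (predC P))
                (lcat (letters P) (lcat (lstar (letters (predC P))) (letters P)))).

Definition all_words : lang (alphabet k) := lstar (letters predT).

(* [LX i] and [LY i] are meant for [1 <= i <= k], where no subtraction truncates. *)
Definition LX (i : nat) : olang (alphabet k) :=
  ounion (locat (even_expr (isX i)) (lomega (letters (isa 0 (4 * k - 2 * i + 1)))))
         (locat all_words (lomega (letters (isa 0 (4 * k - 2 * i))))).

Definition LY (i : nat) : olang (alphabet k) :=
  ounion (locat (even_expr (isY i)) (lomega (letters (isa (2 * i - 2) (4 * k - 1)))))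
         (locat all_words (lomega (letters (isa (2 * i - 1) (4 * k - 1))))).

Definition target_olang : olang (alphabet k) :=
  ointer (chain_olang k LX) (chain_olang k LY).

End Languages.

Arguments LX : clear implicits.
Arguments LY : clear implicits.
Arguments target_olang : clear implicits.

(* Main.v *)
(* Let S be the set of letters recurring in a word w and p the final parities of its
   numbers of X_i and Y_i. These determine the index x of w in the first chain and its
   index y in the second one; w is in the target iff x and y are even. For k >= 2 the
   residuals of the target are the parity vectors, so residual invariant injections
   preserve p, enlarge S arbitrarily, and thus lower x and y arbitrarily. The natural
   color of w is therefore the length [rk] of the longest descent from (x, y) that
   alternates between members and non-members of the target.

   Upper bound: for fixed p, the words of color at least i are those whose letters
   eventually stay in one of k+1 intervals if X_1 is odd, one of k-1 if X_1 is even.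
   A deterministic automaton remembers p and tries these intervals in turn; the
   average of k+1 and k-1 is k.

   Lower bound: in a history-deterministic automaton the state chosen by the advice
   determines the residual, and the words of color at least 2h, h = k/2, have 2^(2h)
   residuals, since the parities of the X_j and Y_j with j even are all relevant. *)
Require Import Defs.
From mathcomp Require Import all_boot all_order all_algebra.
From mathcomp Require Import boolp zify.

Set Implicit Arguments.
Unset Strict Implicit.
Unset Printing Implicit Defensive.

(** * Omega-words *)

Lemma flatten_mkseqS (T : Type) (b : nat -> seq T) n :
  flatten (mkseq b n.+1) = flatten (mkseq b n) ++ b n.
Proof. by rewrite /mkseq -addn1 iotaD map_cat flatten_cat /= cats0. Qed.

Section OmegaWordTheory.
Variable A : finType.
Implicit Types (a : A) (u v : seq A) (w : word A) (P : pred A).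

Lemma wcat_lt a u w n : n < size u -> wcat u w n = nth a u n.
Proof. by elim: u n => [|b u IHu] [|n] //= /IHu. Qed.

Lemma wcat_ge u w n : wcat u w (size u + n) = w n.
Proof. by elim: u. Qed.

Lemma prefix_of_add w m n :
  prefix_of w (m + n) = prefix_of w m ++ prefix_of (fun i => w (m + i)) n.
Proof.
by rewrite /prefix_of /mkseq iotaD map_cat add0n -[X in iota X n]addn0 iotaDl -map_comp.
Qed.

Lemma prefix_ofS w n : prefix_of w n.+1 = rcons (prefix_of w n) (w n).
Proof. by rewrite -addn1 prefix_of_add cats1 addn0. Qed.

Lemma prefix_wcat u w n : prefix_of (wcat u w) (size u + n) = u ++ prefix_of w n.
Proof.
rewrite prefix_of_add; congr (_ ++ _).
  case: u => [//|a u]; apply: (@eq_from_nth _ a) => [|i]; rewrite size_mkseq //.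
  by move=> lti; rewrite nth_mkseq // (wcat_lt a).
by apply: eq_mkseq => i; rewrite wcat_ge.
Qed.

Lemma wcat_prefix w n : w =1 wcat (prefix_of w n) (fun i => w (n + i)).
Proof.
move=> i; case: (ltnP i n) => [ltin|/subnKC <-].
  by rewrite (wcat_lt (w 0)) ?size_mkseq // nth_mkseq.
have := wcat_ge (prefix_of w n) (fun j => w (n + j)) (i - n).
by rewrite size_mkseq.
Qed.

Lemma count_prefix_stable P w N n : (forall m, N <= m -> ~~ P (w m)) -> N <= n ->
  count P (prefix_of w n) = count P (prefix_of w N).
Proof.
move=> PwN /subnKC <-; rewrite prefix_of_add count_cat.
rewrite [X in _ + X](_ : _ = 0) ?addn0 //; apply/eqP.
rewrite -leqn0 leqNgt -has_count; apply/hasPn => x /mapP[i _ ->].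
by apply: PwN; rewrite leq_addr.
Qed.

Definition inf_letters w : {set A} :=
  [set s | `[< infinitely_often (fun n => w n = s) >]].

Lemma inf_lettersP w s :
  reflect (infinitely_often (fun n => w n = s)) (s \in inf_letters w).
Proof. by rewrite inE; apply: asboolP. Qed.

Lemma eventually_inf_letters w :
  exists N, forall n, N <= n -> w n \in inf_letters w.
Proof.
suff [N wN]: exists N, forall s, s \notin inf_letters w -> forall n, N <= n -> w n <> s.
  by exists N => n leNn; apply/negP => /negP/wN/(_ n leNn).
have fin s : exists N, s \notin inf_letters w -> forall n, N <= n -> w n <> s.
  case: (boolP (s \in inf_letters w)) => [_|/inf_lettersP]; first by exists 0.
  move/existsNP => [N notN]; exists N => _ n leNn wn; apply: notN.
  by exists n.
have [f fP] := choice fin; exists (\max_s f s) => s /fP sP n lemax.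
by apply: sP; apply: leq_trans lemax; apply: leq_bigmax.
Qed.

(** * Omega-regular expressions over sets of letters *)

Lemma lstar_cons (U : lang A) v u : U v -> lstar U u -> lstar U (v ++ u).
Proof.
move=> Uv [us Uus ->]; exists (v :: us) => // x; rewrite inE => /predU1P[->//|].
exact: Uus.
Qed.

Lemma lstar_letters P u : lstar (letters P) u <-> all P u.
Proof.
split=> [[us Uus ->]|].
  elim: us Uus => //= v us IHus Uus; rewrite all_cat IHus ?andbT.
    by have [a Pa ->] := Uus v (mem_head _ _); rewrite /= Pa.
  by move=> x xus; apply: Uus; rewrite inE xus orbT.
elim: u => [_|a u IHu /= /andP[Pa /IHu]]; first by exists [::].
by apply: (@lstar_cons _ [:: a]); exists a.
Qed.

Lemma lomega_letters P w : lomega (letters P) w <-> forall n, P (w n).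
Proof.
split=> [[us Uus usw] n|Pw].
  have Pf m : all P (flatten (mkseq us m)).
    elim: m => // m IHm; rewrite flatten_mkseqS all_cat IHm.
    by have [[a Pa ->] _] := Uus m; rewrite /= Pa.
  have size_f m : size (flatten (mkseq us m)) = m.
    elim: m => // m IHm; rewrite flatten_mkseqS size_cat IHm.
    by have [[a Pa ->] _] := Uus m; rewrite addn1.
  have : prefix_of w (size (flatten (mkseq us n.+1))) = flatten (mkseq us n.+1).
    exact: usw.
  rewrite size_f => /(congr1 (all P)); rewrite Pf => /allP; apply.
  by apply: map_f; rewrite mem_iota add0n leqnn.
exists (fun n => [:: w n]) => [n|n]; first by split=> //; exists (w n).
by rewrite /mkseq flatten_map1 size_map size_iota.
Qed.

Lemma locat_lomega (U : lang A) P w : locat U (lomega (letters P)) w <->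
  exists2 N, U (prefix_of w N) & forall n, N <= n -> P (w n).
Proof.
split=> [[u [w' [Uu /lomega_letters Pw' ww']]]|[N UN PN]].
  exists (size u) => [|n /subnKC <-]; last by rewrite ww' wcat_ge.
  suff -> : prefix_of w (size u) = u by [].
  rewrite /prefix_of (eq_mkseq ww').
  by have := prefix_wcat u w' 0; rewrite addn0 cats0.
exists (prefix_of w N), (fun i => w (N + i)); split=> //.
  by apply/lomega_letters => n; apply: PN; rewrite leq_addr.
exact: wcat_prefix.
Qed.

(** * Infinite concatenations of nonempty blocks *)

Lemma size_inf_concat (b : nat -> seq A) n :
  (forall i, b i <> [::]) -> n <= size (flatten (mkseq b n)).
Proof.
move=> b_neq0; elim: n => // n IHn; rewrite flatten_mkseqS size_cat -addn1.
by rewrite leq_add //; case: (b n) (b_neq0 n).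
Qed.

Lemma is_inf_concat_exists (b : nat -> seq A) : (forall n, b n <> [::]) ->
  exists w, is_inf_concat b w.
Proof.
move=> b_neq0; pose p n := flatten (mkseq b n).
have pD m n : exists q, p (m + n) = p m ++ q.
  rewrite /p /mkseq iotaD map_cat flatten_cat.
  by exists (flatten (map b (iota (0 + m) n))).
have size_p n : n <= size (p n) by apply: size_inf_concat.
have [x0 _] : exists x : A, True by case: (b 0) (b_neq0 0) => // x; exists x.
(* The first [i.+1] blocks are nonempty and so hold more than [i] letters: the default [x0] is never
   returned. *)
exists (fun i => nth x0 (p i.+1) i) => n; rewrite -/(p n).
apply: (@eq_from_nth _ x0) => [|i]; rewrite size_mkseq // => ltin.
rewrite nth_mkseq //; have [q1 e1] := pD i.+1 n; have [q2 e2] := pD n i.+1.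
have := congr1 (fun s => nth x0 s i) e1; rewrite addnC e2 !nth_cat ltin.
by rewrite (leq_trans _ (size_p i.+1)).
Qed.

End OmegaWordTheory.

Lemma inf_concat_nth (A : finType) (x0 : A) (b : nat -> seq A) w n i :
  is_inf_concat b w -> i < size (b n) ->
  w (size (flatten (mkseq b n)) + i) = nth x0 (b n) i.
Proof.
move=> bw lti; set m := size _.
have : prefix_of w (size (flatten (mkseq b n.+1))) = flatten (mkseq b n.+1) by exact: bw.
move/(congr1 (fun s => nth x0 s (m + i))); rewrite flatten_mkseqS.
rewrite nth_mkseq ?size_cat ?ltn_add2l // => ->.
by rewrite nth_cat ltnNge leq_addr /= addKn.
Qed.

(** For the converse, cut greedily: a letter outside [P] is a block, and a letter in [P] is paired
    with the next one, which exists because the remaining count is odd. *)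
Lemma count_even_expr k (P : pred (alphabet k)) u :
  even_expr P u <-> ~~ odd (count P u).
Proof.
have count0 v : all (predC P) v -> count P v = 0.
  by rewrite all_predC has_count -leqNgt leqn0 => /eqP.
split=> [[us Uus ->]|].
  elim: us Uus => //= v us IHus Uus; rewrite count_cat oddD.
  rewrite (negbTE (IHus _)) ?addbF; last first.
    by move=> x xus; apply: Uus; rewrite inE xus orbT.
  have [[a /= Pa ->]|] := Uus v (mem_head _ _); first by rewrite /= (negbTE Pa).
  case=> _ [_ [[a Pa ->] [u1 [_ [/lstar_letters/count0 u1P [b Pb ->] ->]]] ->]].
  by rewrite /= count_cat u1P /= Pa Pb.
have [n] := ubnP (size u); elim: n u => // n IHn [|a u] /=; first by exists [::].
rewrite ltnS => leun; case: (boolP (P a)) => Pa /=; last first.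
  move/(IHn _ leun) => uP; apply: (@lstar_cons _ _ [:: a]) => //.
  by left; exists a.
rewrite negbK => uP; have hasP : has P u by rewrite has_count odd_gt0.
case: (split_find hasP) uP leun => b u1 u2 Pb u1P.
rewrite -cats1 !size_cat !count_cat count0 /=; last by rewrite all_predC.
rewrite Pb !add1n add0n /= => /IHn u2P len.
rewrite -cat_cons; apply: lstar_cons.
  right; exists [:: a], (u1 ++ [:: b]); split=> //; first by exists a.
  exists u1, [:: b]; split=> //; last by exists b.
  by apply/lstar_letters; rewrite all_predC.
by apply: u2P; apply: leq_ltn_trans len; apply: leq_addl.
Qed.

(** * The rank of a pair of levels *)

(* The number of membership changes, with respect to the target, on the longest
   alternating descent from the pair of levels [(x, y)]; a pair of levels is in the
   target when both are even. If [e] (resp. [f]), the number of [X_1] (resp. [Y_1])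
   is even, so that level [0] of that chain is not available and level [1] only lies
   above the words with infinitely many [X]'s or [Y]'s, which are in the target. *)
Definition rk (e f : bool) (x y : nat) : nat :=
  if e && (x == 1) || f && (y == 1) then 1
  else x + y - (odd x && odd y) - (e && f).*2.

Definition valid_levels (e f : bool) (x y : nat) : bool :=
  (e ==> (0 < x)) && (f ==> (0 < y)).

Lemma rk00 e f : rk e f 0 0 = 0.
Proof. by case: e f => [] []. Qed.

(** Raising one level by 1 raises the sum by 1 and the correction by at most 1. *)
Lemma add_odd_mono x y x' y' : x' <= x -> y' <= y ->
  x' + y' - (odd x' && odd y') <= x + y - (odd x && odd y).
Proof.
have stepl a b : a + b - (odd a && odd b) <= a.+1 + b - (odd a.+1 && odd b).
  by rewrite /=; case: (odd a) (odd b) => [] [] /=; lia.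
have stepr a b : a + b - (odd a && odd b) <= a + b.+1 - (odd a && odd b.+1).
  by rewrite /=; case: (odd a) (odd b) => [] [] /=; lia.
move=> lex ley.
apply: (@leq_trans (x + y' - (odd x && odd y'))).
  exact: (homo_leq (f := fun a => a + y' - (odd a && odd y')) (@leqnn) (@leq_trans)).
exact: (homo_leq (f := fun b => x + b - (odd x && odd b)) (@leqnn) (@leq_trans)).
Qed.

Lemma valid_ge2 e f x y : valid_levels e f x y ->
  (e && (x == 1) || f && (y == 1)) = false -> (e -> 1 < x) /\ (f -> 1 < y).
Proof. by case: x => [|[|x]]; case: y => [|[|y]]; case: e; case: f. Qed.

Lemma odd_rk e f x y : valid_levels e f x y -> odd (rk e f x y) = odd x || odd y.
Proof.
move=> val; rewrite /rk; case: ifP => [|exc].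
  by case/orP=> /andP[_ /eqP->]; rewrite ?orbT.
have le_xy : (odd x && odd y) <= x + y by case: x {val exc} => // x; case: (_ && _).
have odd_core : odd (x + y - (odd x && odd y)) = odd x || odd y.
  by rewrite oddB // oddD oddb; case: (odd x) (odd y) => [] [].
have [x2 y2] := valid_ge2 val exc.
case: (boolP (e && f)) => [/andP[/x2 x_gt1 /y2 y_gt1]|_]; last by rewrite subn0.
(* Both levels are at least 2, so subtracting 2 does not truncate and keeps the parity. *)
rewrite oddB ?odd_core ?addbF // /=.
exact: leq_trans (add_odd_mono x_gt1 y_gt1).
Qed.

Lemma rk_mono e f x y x' y' : valid_levels e f x' y' ->
  x' <= x -> y' <= y -> rk e f x' y' <= rk e f x y.
Proof.
move=> val lex ley.
have val' : valid_levels e f x y.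
  case/andP: val => vx vy; apply/andP; split; apply/implyP => h.
    by apply: leq_trans lex; apply: implyP h.
  by apply: leq_trans ley; apply: implyP h.
rewrite /rk; case: ifP => exc'; case: ifP => exc //.
- have [x2 y2] := valid_ge2 val' exc.
  case: (boolP (e && f)) => [/andP[/x2 x_gt1 /y2 y_gt1]|_].
    rewrite ltn_subRL; apply: leq_trans (add_odd_mono x_gt1 y_gt1).
    by [].
  rewrite subn0; case/orP: exc' => /andP[h _].
    by apply: leq_trans (add_odd_mono (x2 h) (leq0n y)).
  by apply: leq_trans (add_odd_mono (leq0n x) (y2 h)).
- have [x2 y2] := valid_ge2 val exc'.
  case/orP: exc => /andP[h /eqP e1]; [move: (x2 h) | move: (y2 h)];
    by rewrite ltnNge -e1 ?lex ?ley.
by rewrite leq_sub2r // add_odd_mono.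
Qed.

(** If both levels are odd, decrement both; if one is odd, decrement that one; if both are even,
    decrement one that stays above the exceptional level 1. From rank 1, rank 0 may only be reached
    at levels that are not valid. *)
Lemma rk_step e f x y : valid_levels e f x y -> 1 < rk e f x y ->
  exists x' y', [/\ x' <= x, y' <= y, valid_levels e f x' y' &
                    rk e f x' y' = (rk e f x y).-1].
Proof.
rewrite {1 3}/rk; case: ifP => // exc /valid_ge2/(_ exc) [x2 y2] r_gt1.
have exc_x a b : (e -> 1 < a) -> (f -> 1 < b) ->
    valid_levels e f a b /\ rk e f a b = a + b - (odd a && odd b) - (e && f).*2.
  rewrite /valid_levels /rk; clear.
  case: e => [/(_ isT) a2|_]; case: f => [/(_ isT) b2|_] //=.
  - by case: a b a2 b2 => [|[|a]] [|[|b]].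
  - by case: a a2 => [|[|a]].
  by case: b b2 => [|[|b]].
have good a b : (e -> 1 < a) -> (f -> 1 < b) -> a <= x -> b <= y ->
    a + b - (odd a && odd b) - (e && f).*2 =
      (x + y - (odd x && odd y) - (e && f).*2).-1 ->
    exists x' y', [/\ x' <= x, y' <= y, valid_levels e f x' y' &
      rk e f x' y' = (x + y - (odd x && odd y) - (e && f).*2).-1].
  move=> a2 b2 lea leb eab; have [val rab] := exc_x a b a2 b2.
  by exists a, b; rewrite rab.
have pred_gt1 (h : bool) a : odd a = false -> (h -> 1 < a.+1) -> h -> 1 < a.
  by move=> oa a2 /a2; case: a oa {a2} => [|[]].
case ox: (odd x) good r_gt1; case oy: (odd y) => good r_gt1 //=.
- case: x y ox oy x2 y2 good {exc r_gt1} => [//|x] [//|y] /= ox oy x2 y2 good.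
  have {}ox := negbTE ox; have {}oy := negbTE oy.
  apply: (good x y) => //; [exact: pred_gt1 x2 | exact: pred_gt1 y2 |].
  by rewrite ox oy; case: (e && f) => /=; lia.
- case: x ox x2 good {exc r_gt1} => [//|x] /= ox x2 good; have {}ox := negbTE ox.
  apply: (good x y) => //; first exact: pred_gt1 x2.
  by rewrite ox; case: (e && f) => /=; lia.
- case: y oy y2 good {exc r_gt1} => [//|y] /= oy y2 good; have {}oy := negbTE oy.
  apply: (good x y) => //; first exact: pred_gt1 y2.
  by rewrite oy andbF; case: (e && f) => /=; lia.
have [/andP[x_gt1 x4]|x_small] := boolP ((1 < x) && (e ==> (3 < x))).
  case: x x_gt1 x4 ox x2 good {exc r_gt1} => // x x_gt0 x4 /negbFE ox x2 good.
  apply: (good x y) => //; first by move=> he; move: x4; rewrite he; apply: ltnW.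
  by rewrite oy andbF; case: (e && f) => /=; lia.
have [/andP[y_gt1 y4]|y_small] := boolP ((1 < y) && (f ==> (3 < y))).
  case: y y_gt1 y4 oy y2 good {exc r_gt1} => // y y_gt0 y4 /negbFE oy y2 good.
  apply: (good x y) => //; first by move=> hf; move: y4; rewrite hf; apply: ltnW.
  by rewrite ox; case: (e && f) => /=; lia.
have small (h : bool) a : odd a = false -> (h -> 1 < a) ->
    ~~ ((1 < a) && (h ==> (3 < a))) -> a = h.*2.
  by case: h a => [] [|[|[|[|a]]]] //= _ /(_ isT).
(* Both levels are now minimal: 2 if the first letter is even, 0 otherwise. The rank is 2, and going
   down to an exceptional level 1 makes it 1. *)
have ex := small _ _ ox x2 x_small; have ey := small _ _ oy y2 y_small.
move: r_gt1; rewrite {}ex {}ey; case: (e); case: (f) => // _.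
- by exists 1, 2.
- by exists 1, 0.
by exists 0, 1.
Qed.

(** * Levels *)

Section Levels.
Variable k : nat.
Local Notation A := (alphabet k).
Implicit Types (b : bool) (u v : seq A) (w : word A) (S : {set A}) (i : nat).

(* Everything is stated uniformly for the two chains: [b = false] is the chain
   [LX] with the letters [X_i], [b = true] the chain [LY] with the letters [Y_i]. *)
Definition parities := {ffun 'I_k + 'I_k -> bool}.
Implicit Types p q : parities.

Definition par u : parities := [ffun c => odd (count_mem (inl c : A) u)].

Definition padd p q : parities := [ffun c => p c (+) q c].

Definition side b (j : 'I_k) : 'I_k + 'I_k := if b then inr j else inl j.

(* The parity of the letter of index [i] (counted from 1) of chain [b]. *)
Definition bit b p i : bool :=
  if insub i.-1 is Some j then p (side b j) else false.

Definition sideP b i : pred A := if b then isY i else isX i.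

Definition isA (c : A) : bool := if c is inr _ then true else false.

(* Reversing [a_0, ..., a_(4k-1)] exchanges the two chains. *)
Definition depth b (t : nat) : nat := if b then t else 4 * k - 1 - t.

(** Once the parities are fixed, the two alternatives of the [i]-th language amount to one bound on
    the depth, stricter by 1 when the parity is odd. *)
Definition fit b p i : pred A :=
  fun c => if c is inr t then 2 * i - 2 + bit b p i <= depth b t else false.

(* [S] stands for the set of letters recurring in a word; the level is 0 if the word is
   in no language of the chain. *)
Definition lev b p S : nat :=
  \max_(i < k.+1 | (0 < i) && (S \subset fit b p i)) i.

Lemma par_cat u v : par (u ++ v) = padd (par u) (par v).
Proof. by apply/ffunP => c; rewrite !ffunE count_cat oddD. Qed.

Lemma paddNN p : padd p p = [ffun=> false].
Proof. by apply/ffunP => c; rewrite !ffunE addbb. Qed.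

Lemma padd0 p : padd p [ffun=> false] = p.
Proof. by apply/ffunP => c; rewrite !ffunE addbF. Qed.

Lemma padd_id p q : padd p q = p -> q = [ffun=> false].
Proof.
move=> e; apply/ffunP => c; move/ffunP/(_ c): e; rewrite !ffunE.
by case: (p c); case: (q c).
Qed.

Lemma par_surj p : exists u, par u = p.
Proof.
exists [seq inl c : A | c <- enum [pred c | p c]]; apply/ffunP => c.
rewrite ffunE count_map -(eq_count (a1 := pred1 c)); last first.
  by move=> x /=; rewrite (inj_eq (@inl_inj _ _)).
by rewrite count_uniq_mem ?enum_uniq // mem_enum inE oddb.
Qed.

Lemma bitE b p (j : 'I_k) : bit b p j.+1 = p (side b j).
Proof. by rewrite /bit /= valK. Qed.

Lemma odd_count_sideP b i u : 0 < i <= k ->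
  odd (count (sideP b i) u) = bit b (par u) i.
Proof.
case: i => // i /= ltik; rewrite (bitE b _ (Ordinal ltik)) ffunE; congr odd.
apply: eq_count => -[[j|j]|j]; rewrite /sideP /side; case: b => //=.
Qed.

Lemma fit_isA b p i c : fit b p i c -> isA c.
Proof. by case: c. Qed.

(** This holds whatever the parities are: for [i' < i], even the strict bound [2 * i' - 1] is below
    [2 * i - 2]. *)
Lemma fit_down b p i i' c : i' <= i -> 0 < i' -> fit b p i c -> fit b p i' c.
Proof.
move=> lei i'_gt0; case: c => //= t; case: (ltngtP i' i) lei => [lti|//|->//] _.
by case: (bit _ _ i'); lia.
Qed.

Lemma fits_down b p S i i' : i' <= i -> 0 < i' ->
  S \subset fit b p i -> S \subset fit b p i'.
Proof. by move=> lei i'0 /subsetP S_fit; apply/subsetP => c /S_fit; apply: fit_down. Qed.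

Lemma lev_le b p S : lev b p S <= k.
Proof. by apply/bigmax_leqP => i _; rewrite -ltnS. Qed.

Lemma levP b p S i : 0 < i <= k -> (i <= lev b p S) = (S \subset fit b p i).
Proof.
case/andP=> i_gt0 leik; apply/idP/idP => [|S_fit].
  apply: contraLR => S_unfit; rewrite -ltnNge -(prednK i_gt0) ltnS.
  apply/bigmax_leqP => j /andP[j_gt0 Sj]; rewrite -ltnS prednK // ltnNge.
  by apply: contra S_unfit => leij; apply: fits_down Sj.
apply: (@leq_bigmax_cond _ _ (fun j : 'I_k.+1 => nat_of_ord j)
  (Ordinal (leik : i < k.+1))).
by rewrite /= i_gt0.
Qed.

Lemma lev_uniq b p S x : x <= k ->
  (forall i, 0 < i <= k -> (S \subset fit b p i) = (i <= x)) -> lev b p S = x.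
Proof.
move=> lexk S_fit; apply/eqP; rewrite eqn_leq; apply/andP; split.
  case: (posnP (lev b p S)) => [->//|gt0].
  by rewrite -S_fit ?gt0 ?lev_le // -levP ?gt0 ?lev_le.
case: (posnP x) => [->//|gt0].
by rewrite levP ?gt0 // S_fit ?gt0.
Qed.

Lemma lev_anti b p S S' : S \subset S' -> lev b p S' <= lev b p S.
Proof.
move=> sub; case: (posnP (lev b p S')) => [->//|gt0].
have bnd : 0 < lev b p S' <= k by rewrite gt0 lev_le.
by rewrite levP // (subset_trans sub) // -levP.
Qed.

Lemma lev_notA b p S : ~~ (S \subset isA) -> lev b p S = 0.
Proof.
move=> S_notA; apply: lev_uniq => // i /andP[i_gt0 _]; rewrite leqNgt i_gt0 /=.
apply: contraNF S_notA => /subsetP S_fit; apply/subsetP => c /S_fit.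
exact: fit_isA.
Qed.

Lemma lev_gt0 b p S : 0 < k -> S \subset isA -> ~~ bit b p 1 -> 0 < lev b p S.
Proof.
move=> k_gt0 /subsetP SA /negbTE p1; rewrite levP ?k_gt0 //.
by apply/subsetP => c /SA; rewrite !unfold_in /fit; case: c => //= t _; rewrite p1.
Qed.

(** The level of a set is the minimum over its letters: some letter violates the bound of the next
    level. *)
Lemma lev_attained b p S : S != set0 ->
  exists2 c, c \in S & lev b p [set c] <= lev b p S.
Proof.
case/set0Pn => c0 c0S; case: (eqVneq (lev b p S) k) => [->|].
  by exists c0; rewrite ?lev_le.
move=> neq; have ltk : lev b p S < k by rewrite ltn_neqAle neq lev_le.
have : ~~ (S \subset fit b p (lev b p S).+1) by rewrite -levP // ltnn.
case/subsetPn => c cS c_unfit; exists c => //.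
rewrite -ltnS ltnNge levP //; apply: contra c_unfit => /subsetP; apply.
exact: set11.
Qed.

(** * The rank of a set of recurring letters *)

Definition rank p S : nat :=
  rk (~~ bit false p 1) (~~ bit true p 1) (lev false p S) (lev true p S).

Lemma rank_notA p S : ~~ (S \subset isA) -> rank p S = 0.
Proof. by move=> S_notA; rewrite /rank !lev_notA // rk00. Qed.

Lemma valid_lev p S : 0 < k -> S \subset isA ->
  valid_levels (~~ bit false p 1) (~~ bit true p 1) (lev false p S) (lev true p S).
Proof. by move=> k_gt0 SA; apply/andP; split; apply/implyP; apply: lev_gt0. Qed.

Lemma rank_anti p p' S S' : 0 < k -> S \subset S' -> (S' \subset isA -> p' = p) ->
  rank p' S' <= rank p S.
Proof.
move=> k_gt0 sub; case: (boolP (S' \subset isA)) => [S'A ->//|S'A _].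
  by apply: rk_mono; rewrite ?lev_anti // valid_lev.
by rewrite rank_notA.
Qed.

Lemma odd_rank p S : 0 < k ->
  odd (rank p S) = odd (lev false p S) || odd (lev true p S).
Proof.
move=> k_gt0; case: (boolP (S \subset isA)) => SA; first exact/odd_rk/valid_lev.
by rewrite rank_notA // !lev_notA.
Qed.

Lemma rank_le p S : rank p S <= 2 * k.
Proof.
have := lev_le false p S; have := lev_le true p S.
by rewrite /rank /rk; case: ifP; lia.
Qed.

Lemma letter_of_depth b d : d < 4 * k ->
  exists t : 'I_(4 * k), depth b t = d /\ depth (~~ b) t = 4 * k - 1 - d.
Proof.
move=> ltd; rewrite /depth; case: b => /=; first by exists (Ordinal ltd).
by exists (rev_ord (Ordinal ltd)); rewrite /= ; lia.
Qed.

(** Depth [2 * z - 1] satisfies both bounds of level [z] and neither of level [z.+1]; in the other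
    chain it is deep enough for all levels. For [z = 0] the depth truncates to 0, which excludes
    level 1 only if the first parity is odd. *)
Lemma cap_letter b z : z <= k -> 0 < k -> exists c : A, [/\ isA c,
  forall p i, 0 < i <= k -> fit (~~ b) p i c &
  forall p, (~~ bit b p 1 ==> (0 < z)) ->
    forall i, 0 < i <= k -> fit b p i c = (i <= z)].
Proof.
move=> lezk k_gt0; have [|t [dt dt']] := @letter_of_depth b (2 * z - 1); first by lia.
exists (inr t); split=> // [p i ik|p z0 i ik] /=; first by rewrite dt'; lia.
rewrite dt; case: (ltngtP i z) => [lti|lti|eqi]; case: (boolP (bit b p i)) => pi; try lia.
case: (ltnP 1 i) => [|le1]; first by lia.
by have i1 : i = 1 by [lia]; rewrite i1 in pi; rewrite pi /= in z0; lia.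
Qed.

Lemma fitsU1 b p i c S :
  (c |: S \subset fit b p i) = fit b p i c && (S \subset fit b p i).
Proof.
apply/subsetP/andP => [sub|[fc /subsetP sub] d]; last by case/setU1P => [->//|/sub].
split; first by apply: (sub c); rewrite setU11.
by apply/subsetP => d dS; apply: (sub d); rewrite setU1r.
Qed.

Lemma isAU1 c S : (c |: S \subset isA) = isA c && (S \subset isA).
Proof.
apply/subsetP/andP => [sub|[Ac /subsetP sub] d]; last by case/setU1P => [->//|/sub].
split; first by apply: (sub c); rewrite setU11.
by apply/subsetP => d dS; apply: (sub d); rewrite setU1r.
Qed.

(** One cap letter per chain lowers the two levels independently, as each of them fits every level
    of the other chain. *)
Lemma cap_levels p S x y : 0 < k -> S \subset isA -> x <= k -> y <= k ->
  valid_levels (~~ bit false p 1) (~~ bit true p 1) x y ->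
  exists S', [/\ S \subset S', S' \subset isA,
    lev false p S' = minn (lev false p S) x &
    lev true p S' = minn (lev true p S) y].
Proof.
move=> k_gt0 SA lex ley /andP[vx vy].
have [c [cA c_fit c_cap]] := @cap_letter false x lex k_gt0.
have [d [dA d_fit d_cap]] := @cap_letter true y ley k_gt0.
exists (c |: (d |: S)); split.
- by rewrite setUA subsetUr.
- by rewrite !isAU1 cA dA.
- apply: lev_uniq => [|i ik]; first by rewrite geq_min lex orbT.
  by rewrite !fitsU1 c_cap // d_fit // -levP // leq_min andbC.
apply: lev_uniq => [|i ik]; first by rewrite geq_min ley orbT.
by rewrite !fitsU1 d_cap // c_fit // -levP // leq_min /= andbC.
Qed.

Lemma rank_step p S : 0 < k -> S \subset isA -> 1 < rank p S ->
  exists S', [/\ S \subset S', S' \subset isA & rank p S' = (rank p S).-1].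
Proof.
move=> k_gt0 SA /(rk_step (valid_lev p k_gt0 SA))[x [y [lex ley val e]]].
have [||S' [sub S'A lx ly]] := @cap_levels p S x y k_gt0 SA _ _ val.
- exact: leq_trans lex (lev_le _ _ _).
- exact: leq_trans ley (lev_le _ _ _).
by exists S'; split=> //; rewrite /rank lx ly -e (minn_idPr lex) (minn_idPr ley).
Qed.

(* Two letters whose alternation reveals the parity of index [j] of chain [b]. *)
Lemma probe b (j : 'I_k) z : z <= k -> exists s t : A, [/\ isA s, isA t &
  forall p, (~~ bit (~~ b) p 1 ==> (0 < z)) ->
    lev b p [set s; t] = j + ~~ p (side b j) /\ lev (~~ b) p [set s; t] = z].
Proof.
move=> lezk; have k_gt0 : 0 < k by case: j => j; apply: leq_ltn_trans.
have ltjk := ltn_ord j.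
(* Depth [2 * j] meets the bounds of all indices up to [j], and that of [j.+1] exactly when its
   parity is even. The letter [t] only caps the other chain, at [z]. *)
have [|s [ds ds']] := @letter_of_depth b (2 * j); first by lia.
have [t [tA t_fit t_cap]] := @cap_letter (~~ b) z lezk k_gt0.
rewrite negbK in t_fit.
exists (inr s), t; split=> // p z0.
have fits2 b' p' i :
    ([set inr s; t] \subset fit b' p' i) = fit b' p' i (inr s) && fit b' p' i t.
  rewrite fitsU1; congr (_ && _); apply/subsetP/idP => [|ft c /set1P->//].
  by apply; apply: set11.
split.
  apply: lev_uniq => [|i ik]; first by case: (p _); lia.
  rewrite fits2 t_fit // andbT -bitE /= ds.
  case: (ltngtP i j.+1) => [lti|lti|->]; last by case: (bit b p j.+1); lia.
    by case: (bit b p i); case: (bit b p j.+1); lia.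
  by case: (bit b p i); case: (bit b p j.+1); lia.
apply: lev_uniq => // i ik; rewrite fits2 t_cap //= ds'.
by rewrite [X in X && _](_ : _ = true) //; case: (bit _ _ i); lia.
Qed.

End Levels.

(** * Tail classes of words *)

Section Classes.
Variable k : nat.
Local Notation A := (alphabet k).
Implicit Types (b : bool) (u v : seq A) (w : word A) (S : {set A}) (i : nat).
Implicit Types p q : parities k.

(** The vector [p] is an invariant of [w] only if [S] consists of letters [a_t]; otherwise it
    depends on the choice of [N]. *)
Definition tail_class w p S N : Prop :=
  [/\ forall n, N <= n -> w n \in S,
      forall s, s \in S -> infinitely_often (fun n => w n = s)
    & par (prefix_of w N) = p].

Lemma tail_class_exists w : exists p S N, tail_class w p S N.
Proof.
have [N wN] := eventually_inf_letters w.
exists (par (prefix_of w N)), (inf_letters w), N; split=> // s.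
by move/inf_lettersP.
Qed.

Lemma par_prefix_stable w N n : (forall m, N <= m -> isA (w m)) -> N <= n ->
  par (prefix_of w n) = par (prefix_of w N).
Proof.
move=> wA leNn; apply/ffunP => c; rewrite !ffunE; congr odd.
by apply: count_prefix_stable leNn => m /wA /=; case: (w m).
Qed.

Lemma par_stable w p S N n : S \subset @isA k -> tail_class w p S N -> N <= n ->
  par (prefix_of w n) = p.
Proof.
move=> /subsetP SA [wS _ <-]; apply: par_prefix_stable => m /wS; exact: SA.
Qed.

Lemma tail_eventually w p S N (P : pred A) : tail_class w p S N ->
  (exists N', forall n, N' <= n -> P (w n)) <-> S \subset P.
Proof.
case=> wS Sinf _; split=> [[N' PN']|/subsetP SP]; last by exists N => n /wS/SP.
by apply/subsetP => s /Sinf/(_ N')[n leN'n <-]; apply: PN'.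
Qed.

Lemma tail_class_wcat u w q S N : tail_class w q S N ->
  tail_class (wcat u w) (padd (par u) q) S (size u + N).
Proof.
case=> wS Sinf wq; split=> [n lenn|s /Sinf s_inf n|].
- have leun : size u <= n by apply: leq_trans lenn; apply: leq_addr.
  by rewrite -(subnKC leun) wcat_ge; apply: wS; rewrite leq_subRL.
- have [m lenm <-] := s_inf n; exists (size u + m); last exact: wcat_ge.
  exact: leq_trans lenm (leq_addl _ _).
by rewrite prefix_wcat par_cat wq.
Qed.

Definition alternate (s t : A) : word A := fun n => if odd n then s else t.

Lemma alternate_class s t : tail_class (alternate s t) [ffun=> false] [set s; t] 0.
Proof.
split=> [n _|r|]; first by rewrite /alternate; case: ifP; rewrite ?set21 ?set22.
  case/set2P => -> n; first by exists n.*2.+1; rewrite /alternate /= ?odd_double //=; lia.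
  by exists n.*2; rewrite /alternate /= ?odd_double //=; lia.
by apply/ffunP => c; rewrite !ffunE.
Qed.

Definition threshold b d : pred A :=
  fun c => if c is inr t then d <= depth k b t else false.

Definition chainL b i : olang A := if b then LY k i else LX k i.

(** Measured by depth, the letter intervals of both chains become the same lower bounds. *)
Lemma chainLE b i w : 0 < i <= k -> chainL b i w <->
  (exists2 N, ~~ odd (count (sideP b i) (prefix_of w N)) &
              forall n, N <= n -> threshold b (2 * i - 2) (w n))
  \/ (exists N, forall n, N <= n -> threshold b (2 * i - 1) (w n)).
Proof.
move=> ik; pose lo1 := if b then 2 * i - 2 else 0.
pose lo2 := if b then 2 * i - 1 else 0.
pose hi1 := if b then 4 * k - 1 else 4 * k - 2 * i + 1.
pose hi2 := if b then 4 * k - 1 else 4 * k - 2 * i.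
have thr1 : isa lo1 hi1 =1 threshold b (2 * i - 2).
  move=> [//|t] /=; rewrite /depth /lo1 /hi1; have := ltn_ord t.
  by case: b {lo1 lo2 hi1 hi2}; lia.
have thr2 : isa lo2 hi2 =1 threshold b (2 * i - 1).
  move=> [//|t] /=; rewrite /depth /lo2 /hi2; have := ltn_ord t.
  by case: b {lo1 lo2 hi1 hi2 thr1}; lia.
have -> : chainL b i = ounion
    (locat (even_expr (sideP b i)) (lomega (letters (isa lo1 hi1))))
    (locat (@all_words k) (lomega (letters (isa lo2 hi2)))).
  by rewrite /lo1 /lo2 /hi1 /hi2; case: b {thr1 thr2 lo1 lo2 hi1 hi2}.
split; case.
- case/locat_lomega => N /count_even_expr Neven wN.
  by left; exists N => // n /wN; rewrite thr1.
- case/locat_lomega => N _ wN; right; exists N => n /wN; by rewrite thr2.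
- case=> N Neven wN; left; apply/locat_lomega; exists N; first exact/count_even_expr.
  by move=> n /wN; rewrite thr1.
case=> N wN; right; apply/locat_lomega; exists N => [|n /wN]; last by rewrite thr2.
by apply/lstar_letters; apply/allP.
Qed.

Lemma chainL_fit b i w p S N : 0 < i <= k -> tail_class w p S N ->
  chainL b i w <-> S \subset fit b p i.
Proof.
move=> ik clw.
have bit_par n : S \subset @isA k -> N <= n ->
    odd (count (sideP b i) (prefix_of w n)) = bit b p i.
  by move=> SA leNn; rewrite odd_count_sideP // (par_stable SA clw).
have fitE : fit b p i =1 threshold b (if bit b p i then 2 * i - 1 else 2 * i - 2).
  by move=> [//|t] /=; case: (bit _ _ _) => //=; congr (_ <= _); lia.
have thrA d : S \subset threshold b d -> S \subset @isA k.
  by move=> /subsetP Sd; apply/subsetP => -[c /Sd|].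
have thr_mono d d' : d <= d' -> S \subset threshold b d' -> S \subset threshold b d.
  move=> led /subsetP Sd; apply/subsetP => -[c /Sd//|t /Sd].
  exact: leq_trans.
rewrite (eq_subset_r fitE) chainLE //; split.
  case=> [[n evn Sn]|Sn]; last first.
    have /(tail_eventually _ clw) := Sn; apply: thr_mono.
    by case: ifP => // _; rewrite leq_sub2l.
  have /(tail_eventually _ clw) Sthr :
      exists N', forall n, N' <= n -> threshold b (2 * i - 2) (w n).
    by exists n.
  have SA := thrA _ Sthr; suff -> : bit b p i = false by [].
  (* Only letters [a_t] follow position [n], so the even count found there is still the count beyond
     [N], whose parity is recorded in [p]. *)
  rewrite -(bit_par (maxn n N)) ?leq_maxr // (@count_prefix_stable _ _ _ n) ?leq_maxl //.
    exact: negbTE.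
  by move=> m /Sn; case: (w m) => // t _; rewrite /sideP; case: (b).
move=> Sthr; have SA := thrA _ Sthr; case: (boolP (bit b p i)) Sthr => pi Sthr.
  by right; apply/(tail_eventually _ clw).
left; exists N => [|n leNn]; first by rewrite bit_par.
by case: clw => /(_ n leNn) wS _ _; move/subsetP: Sthr; apply.
Qed.

Lemma chain_olang_level n (Ls : nat -> olang A) w x : 0 < n -> x <= n ->
  (forall i, 0 < i <= n -> Ls i w <-> i <= x) ->
  chain_olang n Ls w <-> ~~ odd x.
Proof.
move=> n_gt0 lexn Lx; split.
  case=> [notL1|[i [ik /(Lx _ ik) leix notL evi]]].
    by case: (posnP x) => [->//|x_gt0]; case: notL1; apply/Lx => //; rewrite n_gt0.
  suff -> : x = i by []; apply/eqP; rewrite eqn_leq leix andbT leqNgt.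
  apply/negP => ltix; case: (notL x); rewrite ?ltix //; apply/Lx => //.
  by rewrite lexn (leq_trans _ ltix).
case: (posnP x) => [x0 _|x_gt0 evx].
  by left; move/(Lx 1); rewrite n_gt0 x0; move/(_ isT).
right; exists x; split; rewrite ?x_gt0 //; first by apply/Lx => //; rewrite x_gt0.
move=> j /andP[ltxj lejn]; move/Lx; rewrite lejn (leq_trans _ ltxj) // => /(_ isT).
by rewrite leqNgt ltxj.
Qed.

Lemma chainL_level b w p S N : 0 < k -> tail_class w p S N ->
  chain_olang k (chainL b) w <-> ~~ odd (lev b p S).
Proof.
move=> k_gt0 clw; apply: chain_olang_level => // [|i ik]; first exact: lev_le.
by rewrite levP //; apply: chainL_fit clw.
Qed.

Lemma target_olang_rank w p S N : 0 < k -> tail_class w p S N ->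
  target_olang k w <-> ~~ odd (rank p S).
Proof.
move=> k_gt0 clw; rewrite odd_rank // negb_or.
have := chainL_level false k_gt0 clw; have := chainL_level true k_gt0 clw.
rewrite /chainL => Y X; split=> [[/X-> /Y->]//|/andP[/X ? /Y ?]]; by split.
Qed.

End Classes.

(** * Natural colors *)

Section NaturalColors.
Variable k : nat.
Hypothesis k_gt1 : 1 < k.
Local Notation A := (alphabet k).
Local Notation L := (target_olang k).
Implicit Types (b : bool) (u v : seq A) (w : word A) (S : {set A}) (i : nat).
Implicit Types p q : parities k.

Let k_gt0 : 0 < k := ltnW k_gt1.

Lemma par_residual u v : par u = par v -> oeq (residual L u) (residual L v).
Proof.
move=> uv w; have [p [S [N clw]]] := tail_class_exists w.
have := target_olang_rank k_gt0 (tail_class_wcat u clw).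
by rewrite uv -(target_olang_rank k_gt0 (tail_class_wcat v clw)).
Qed.

Lemma residual_par u v : oeq (residual L u) (residual L v) -> par u = par v.
Proof.
move=> uv; apply/ffunP => c.
have [b [j ->]] : exists b j, c = side b j.
  by case: c => j; [exists false, j | exists true, j].
(* The other chain is held at level 2, available since [2 <= k]: being positive it suits any
   parities, and being even it leaves membership to chain [b]. *)
have [s [t [sA tA stP]]] := probe b j k_gt1.
have Lst x : L (wcat x (alternate s t)) <-> ~~ odd (j + ~~ par x (side b j)).
  have := target_olang_rank k_gt0 (tail_class_wcat x (alternate_class s t)).
  rewrite padd0 odd_rank //; have [|] := stP (par x); first by rewrite implybT.
  by case: (b) => -> ->; rewrite ?orbF.
have := uv (alternate s t); rewrite /residual !Lst !oddD !oddb => e.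
have : (~~ (odd j (+) ~~ par u (side b j))) = ~~ (odd j (+) ~~ par v (side b j)).
  by apply/idP/idP => /e.
by case: (odd j); case: (par u _); case: (par v _).
Qed.

(** Letters of [w] survive in [w'], and residual invariance makes the parity vector of each injected
    word zero. If only letters [a_t] recur in [w'], parities can be compared late in both words. *)
Lemma injection_class (J : nat -> Prop) w w' p p' S S' N N' :
  tail_class w p S N -> tail_class w' p' S' N' -> injection_result L J w w' ->
  S \subset S' /\ (S' \subset @isA k -> p' = p).
Proof.
move=> clw clw' [v [v0 vJ ww']]; set b := (fun i => w i :: v i) in ww'.
have b_neq0 i : b i <> [::] by [].
have sub : S \subset S'.
  apply/subsetP => s; case: (clw) => _ sinf _ /sinf/(_ N')[n leN'n wn].
  case: clw' => w'S' _ _.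
  have := w'S' (size (flatten (mkseq b n)) + 0).
  rewrite (inf_concat_nth s ww') //= wn addn0; apply.
  exact: leq_trans (size_inf_concat n b_neq0).
split=> // S'A; have SA := subset_trans sub S'A.
have v_par i : par (v i) = [ffun=> false].
  have [/vJ/residual_par|/v0 ->] := EM (J i); last by apply/ffunP => c; rewrite !ffunE.
  by rewrite par_cat => /esym/padd_id.
have b_par n : par (flatten (mkseq b n)) = par (prefix_of w n).
  elim: n => [//|n IHn]; rewrite flatten_mkseqS -(addn1 n) prefix_of_add.
  rewrite !par_cat IHn; congr padd; rewrite /b -cat1s par_cat v_par padd0.
  by rewrite /prefix_of /mkseq /= addn0.
pose n := maxn N N'.
rewrite -(par_stable SA clw (leq_maxl N N')) -b_par -ww'.
rewrite (par_stable S'A clw') //.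
exact: leq_trans (leq_maxr N N') (size_inf_concat _ b_neq0).
Qed.

Lemma injection_exists (J : nat -> Prop) w p S S' N :
  tail_class w p S N -> infinitely_often J -> S \subset S' ->
  exists w' p' N', injection_result L J w w' /\ tail_class w' p' S' N'.
Proof.
move=> [wS Sinf wp] Jinf sub.
(* Listing [S'] twice makes all parities zero, hence the injection residual invariant, while every
   letter of [S'] recurs. *)
pose v i := if `[< J i >] then enum S' ++ enum S' else [::].
pose b i := w i :: v i; have b_neq0 i : b i <> [::] by [].
have [w' ww'] := is_inf_concat_exists b_neq0.
pose pos n := size (flatten (mkseq b n)).
have le_pos n : n <= pos n by apply: size_inf_concat.
have in_block m : pos N <= m ->
    exists n i, [/\ N <= n, m = pos n + i & i < size (b n)].
  move=> leNm; have ex_n : exists n, (N <= n) && (m < pos n.+1).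
    exists (maxn N m); rewrite leq_maxl.
    by apply: leq_trans (le_pos _); rewrite ltnS leq_maxr.
  case: (ex_minnP ex_n) => n /andP[leNn ltm] n_min.
  have lem : pos n <= m.
    case: (eqVneq N n) => [<-//|neqNn].
    have {neqNn leNn} ltNn : N < n by rewrite ltn_neqAle neqNn.
    case: n ltNn n_min {ltm} => // n; rewrite ltnS => leNn n_min.
    rewrite leqNgt; apply/negP => ltm; have := n_min n.
    by rewrite ltm leNn ltnn => /(_ isT).
  exists n, (m - pos n); rewrite subnKC // leNn; split=> //.
  by rewrite ltn_subLR // -size_cat -flatten_mkseqS.
have inS' : exists N', forall n, N' <= n -> w' n \in S'.
  exists (pos N) => m /in_block[n [i [leNn em lti]]].
  rewrite em (inf_concat_nth (w 0) ww') //; case: i lti {em} => [_|i lti] /=.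
    exact/(subsetP sub)/wS.
  have : nth (w 0) (v n) i \in v n by apply: mem_nth.
  by rewrite {2}/v; case: ifP => // _; rewrite mem_cat orbb mem_enum.
have S'inf s : s \in S' -> infinitely_often (fun n => w' n = s).
  move=> sS' n; have [j lenj Jj] := Jinf n.
  have sv : s \in v j by rewrite /v asboolT // mem_cat mem_enum sS'.
  exists (pos j + (index s (v j)).+1).
    exact: leq_trans lenj (leq_trans (le_pos j) (leq_addr _ _)).
  by rewrite (inf_concat_nth s ww') /= ?nth_index // ltnS index_mem.
have [N' w'S'] := inS'.
exists w', (par (prefix_of w' N')), N'; split; last by split.
exists v; split=> // i; first by rewrite /v => /asboolF ->.
move=> Ji; apply: par_residual; rewrite par_cat /v asboolT // par_cat paddNN.
by rewrite padd0.
Qed.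

Lemma at_home_inv i w : at_home L i w -> exists2 J, infinitely_often J &
  forall w', injection_result L J w w' ->
    (exists2 j, j < i & at_home L j w') \/ (L w <-> L w') /\ (L w <-> ~~ odd i).
Proof.
case=> {}i {}w J Jinf home; exists J => // w' /home[|[Lw Lw' ->]|[Lw Lw' ->]].
- by left.
- by right.
by right; split; split.
Qed.

(** Inject anywhere. The rank cannot grow; if it stays, so does membership, and if it drops,
    induction applies. *)
Lemma rank_at_home w p S N : tail_class w p S N -> at_home L (rank p S) w.
Proof.
have [n] := ubnP (rank p S); elim: n => // n IHn in w p S N *; rewrite ltnS => len clw.
apply: (@AtHome _ _ _ _ (fun=> True)) => [m|w' inj]; first by exists m.
have [p' [S' [N' clw']]] := tail_class_exists w'.
have [sub pp'] := injection_class clw clw' inj.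
have := rank_anti k_gt0 sub pp'; rewrite leq_eqVlt => /predU1P[e|lt].
  have Lw := target_olang_rank k_gt0 clw; have Lw' := target_olang_rank k_gt0 clw'.
  rewrite e in Lw'; case: (boolP (odd (rank p S))) Lw Lw' => /= _ Lw Lw'.
    by apply: Or33; split=> //; [move/Lw | move/Lw'].
  by constructor 2; split=> //; [apply/Lw | apply/Lw'].
apply: Or31; exists (rank p' S') => //.
by apply: IHn clw'; apply: leq_trans lt len.
Qed.

Lemma at_home_rank i w p S N : tail_class w p S N -> at_home L i w -> rank p S <= i.
Proof.
have [n] := ubnP i; elim: n => // n IHn in i w p S N *; rewrite ltnS => lein clw.
case/at_home_inv => J Jinf home; rewrite leqNgt; apply/negP => lti.
(* By induction, an injection result of rank at least [i] is not at home below [i]; it must then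
   agree with [w] on membership, that is, on the parity of the rank. *)
have lower S' : S \subset S' -> exists p', (S' \subset @isA k -> p' = p) /\
    (i <= rank p' S' -> odd (rank p' S') = odd (rank p S) /\ (odd (rank p S)) = odd i).
  move=> sub; have [w' [p' [N' [inj clw']]]] := injection_exists clw Jinf sub.
  have [_ pp'] := injection_class clw clw' inj; exists p'; split=> // le_i.
  have [[j ltji homej]|] := home w' inj.
    have := IHn j w' p' S' N' (leq_trans ltji lein) clw' homej.
    by rewrite leqNgt (leq_trans ltji le_i).
  rewrite (target_olang_rank k_gt0 clw) (target_olang_rank k_gt0 clw').
  move=> [r_r' r_i]; split; apply: negb_inj.
    by apply/idP/idP => /r_r'.
  by apply/idP/idP => /r_i.
have [SA|SA] := boolP (S \subset @isA k); last by rewrite rank_notA in lti.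
(* Enlarging [S] so that the rank drops by exactly 1 keeps it at least [i], yet [lower] forbids the
   change of parity. From rank 1, recurrence of all letters gives rank 0. *)
have [p0 [/(_ SA) -> par0]] := lower S (subxx S).
have {par0} [_ par_i] := par0 (ltnW lti).
have [S' [sub S'le]] : exists S', S \subset S' /\
    forall p', (S' \subset @isA k -> p' = p) -> rank p' S' = (rank p S).-1.
  case: (ltnP 1 (rank p S)) => [/(rank_step k_gt0 SA)[S' [sub S'A rS']]|le1].
    by exists S'; split=> // p' ->.
  exists setT; split=> [|p' _]; first exact: subsetT.
  rewrite rank_notA; first by case: (rank p S) lti le1 => [|[]].
  by apply/subsetPn; exists (inl (side false (Ordinal k_gt0)) : A); rewrite ?inE.
have [p' [/S'le -> par']] := lower S' sub.
have r_gt0 : 0 < rank p S by apply: leq_ltn_trans lti.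
case: par' => [|]; first by rewrite -ltnS prednK.
by rewrite -{2}(prednK r_gt0) /=; case: (odd _).
Qed.

Lemma natural_colorE i w p S N : tail_class w p S N ->
  natural_color L w i <-> i = rank p S.
Proof.
move=> clw; split=> [[home min]|->].
  apply/eqP; rewrite eqn_leq (at_home_rank clw home) andbT; apply: min.
  exact: rank_at_home clw.
by split=> [|j]; [apply: rank_at_home clw | apply: at_home_rank clw].
Qed.

(** A word of natural color [r] lies in the [r]-th language and not in the next one; the chain being
    decreasing, this settles every index. *)
Lemma cocoa_accepted C i w p S N : is_cocoa L (2 * k) C -> i <= 2 * k ->
  tail_class w p S N -> accepted (C i) w <-> i <= rank p S.
Proof.
move=> [C0 _ Cdecr Ccol] lei clw; set r := rank p S.
have ler : r <= 2 * k by apply: rank_le.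
have down j j' : j' <= j -> j <= 2 * k -> accepted (C j) w -> accepted (C j') w.
  elim: j => [|j IHj]; first by rewrite leqn0 => /eqP->.
  rewrite leq_eqVlt => /predU1P[->//|lej'] lej Cj.
  case: (posnP j') => [->//|j'_gt0]; apply: IHj; rewrite ?(ltnW lej) //.
  have [] := Cdecr j; first by rewrite lej (leq_trans j'_gt0).
  by move=> sub _; apply: sub.
have [Cr notCr] : accepted (C r) w /\ (r < 2 * k -> ~ accepted (C r.+1) w).
  by apply/(Ccol r w ler)/(natural_colorE r clw).
split=> [Ci|leir]; last exact: down Cr.
rewrite leqNgt; apply/negP => ltri; apply: notCr; first exact: leq_trans lei.
exact: down Ci.
Qed.

End NaturalColors.

(** * The upper bound *)

Lemma accepting_colorsP (c : nat -> nat) : (forall n, (c n == 1) || (c n == 2)) ->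
  accepting_colors c <-> exists N, forall n, N <= n -> c n = 2.
Proof.
move=> c12; split=> [[_ /(_ 1 isT)/existsNP[N notN]]|[N cN]].
  exists N => n leNn; have /orP[/eqP cn|/eqP//] := c12 n.
  by case: notN; exists n.
split=> [n|d ltd2 /(_ N)[n /cN -> d2]]; last by rewrite -d2 in ltd2.
by exists (maxn N n); rewrite ?leq_maxr // cN ?leq_maxl.
Qed.

(* In mode [p] the automaton tries the sets [F p 0], ..., [F p (m p)] in turn: it
   moves on, with color 1, as soon as a letter leaves the current set. *)
Section RoundRobin.
Variables (A P : finType) (g : P -> A -> P) (p0 : P) (m : P -> nat).
Variable F : P -> nat -> {set A}.
Hypothesis F_mode : forall p j c, c \in F p j -> g p c = p.

Definition rr_state : finType := {p : P & 'I_(m p).+1}.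
Implicit Type s : rr_state.

Definition rr_stay s c : bool := c \in F (tag s) (tagged s).

Definition rr_next s c : rr_state :=
  if rr_stay s c then s else
  if g (tag s) c == tag s then Tagged (fun p => 'I_(m p).+1) (ordS (tagged s))
  else Tagged (fun p => 'I_(m p).+1) (ord0 : 'I_(m (g (tag s) c)).+1).

Definition rr_color s c : nat := if rr_stay s c then 2 else 1.

Definition rr_delta s c s' d : bool := (s' == rr_next s c) && (d == rr_color s c).

Lemma rr_delta_color s c s' d : rr_delta s c s' d -> (d == 1) || (d == 2).
Proof. by case/andP=> _ /eqP->; rewrite /rr_color; case: ifP. Qed.

Lemma rr_delta_complete s c : exists s' d, rr_delta s c s' d.
Proof. by exists (rr_next s c), (rr_color s c); rewrite /rr_delta !eqxx. Qed.

Lemma rr_delta_color_uniq s c s1 d1 s2 d2 :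
  rr_delta s c s1 d1 -> rr_delta s c s2 d2 -> d1 = d2.
Proof. by case/andP=> _ /eqP-> /andP[_ /eqP->]. Qed.

Definition round_robin : cobuchi A :=
  Cobuchi (Tagged (fun p => 'I_(m p).+1) (ord0 : 'I_(m p0).+1))
    rr_delta_color rr_delta_complete rr_delta_color_uniq.

Lemma round_robin_deterministic : deterministic round_robin.
Proof.
move=> s c; exists (rr_next s c, rr_color s c); split.
  by rewrite /= /rr_delta !eqxx.
by case=> s' d /andP[/= /eqP-> /eqP->].
Qed.

Lemma nb_states_round_robin : nb_states round_robin = \sum_p (m p).+1.
Proof.
rewrite /nb_states /= /rr_state card_tagged sumnE big_map big_enum /=.
by apply: eq_bigr => p _; rewrite card_ord.
Qed.

Lemma tag_rr_next s c : tag (rr_next s c) = g (tag s) c.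
Proof. by rewrite /rr_next; case: ifP => [/F_mode->//|_]; case: eqP => [->|]. Qed.

Lemma round_robin_accepted w : accepted round_robin w <->
  exists N p j, [/\ j <= m p, foldl g p0 (prefix_of w N) = p
                  & forall n, N <= n -> w n \in F p j].
Proof.
pose r := fix r n : rr_state :=
  if n is n'.+1 then rr_next (r n') (w n') else init round_robin.
have runE (r' : nat -> state round_robin) c : is_run w r' c ->
    r' =1 r /\ forall n, c n = rr_color (r n) (w n).
  case=> r0 r_step; have rE : r' =1 r.
    by elim=> [|n IHn] //=; rewrite -IHn; have /andP[/eqP] := r_step n.
  by split=> // n; have /andP[_ /eqP ->] := r_step n; rewrite -rE.
have r_run : is_run (B := round_robin) w r (fun n => rr_color (r n) (w n)).
  by split=> // n; rewrite /= /rr_delta !eqxx.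
have tag_r n : tag (r n) = foldl g p0 (prefix_of w n).
  elim: n => // n IHn; rewrite -addn1 prefix_of_add foldl_cat -IHn addn1 /=.
  by rewrite tag_rr_next addn0.
have col12 n : (rr_color (r n) (w n) == 1) || (rr_color (r n) (w n) == 2).
  by rewrite /rr_color; case: ifP.
split=> [[r' [c [run acc]]]|[N [p [j [lejm modeN wF]]]]].
  have [rE cE] := runE r' c run.
  have [|N cN] := (accepting_colorsP _).1 acc; first by move=> n; rewrite cE.
  have stay n : N <= n -> rr_stay (r n) (w n).
    by move=> /cN; rewrite cE /rr_color; case: ifP.
  have rN n : N <= n -> r n = r N.
    move/subnKC <-; elim: (n - N) => [|d IHd]; first by rewrite addn0.
    by rewrite addnS /= /rr_next stay ?leq_addr.
  exists N, (tag (r N)), (tagged (r N)); split=> // [|n leNn].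
    by rewrite -ltnS ltn_ord.
  by have := stay n leNn; rewrite /rr_stay rN.
exists r, (fun n => rr_color (r n) (w n)); split=> //.
apply/accepting_colorsP => //.
have mode n : N <= n -> tag (r n) = p.
  move/subnKC <-; elim: (n - N) => [|d IHd]; first by rewrite addn0 tag_r.
  by rewrite addnS /= tag_rr_next IHd (F_mode (wF _ _)) ?leq_addr.
pose x n : nat := tagged (r n).
have stayE n : N <= n -> rr_stay (r n) (w n) = (w n \in F p (x n)).
  by move=> leNn; rewrite /rr_stay -[in RHS](mode n leNn).
have x_stay n : N <= n -> w n \in F p (x n) -> x n.+1 = x n.
  by move=> leNn wn; rewrite /x /= /rr_next stayE // wn.
have x_move n : N <= n -> w n \notin F p (x n) -> x n.+1 = (x n).+1 %% (m p).+1.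
  move=> leNn wn; rewrite /x /= /rr_next stayE // (negbTE wn).
  case: eqP => [_ /=|]; first by rewrite -[in RHS](mode n leNn).
  by case; rewrite (mode n leNn) (F_mode (wF n leNn)).
suff [N' leNN' stay] : exists2 N', N <= N' & forall n, N' <= n -> w n \in F p (x n).
  by exists N' => n leN'n; rewrite /rr_color stayE ?(leq_trans leNN') // stay.
have x_le n : N <= n -> x n <= m p.
  by move=> leNn; rewrite -(mode n leNn) -ltnS ltn_ord.
(* Here [d] counts the moves left before the index is [j], where the automaton stays forever; it may
   also settle in an earlier set. *)
have cycle d n : N <= n -> (x n + d) %% (m p).+1 = j ->
    exists2 N', N <= N' & forall n, N' <= n -> w n \in F p (x n).
  elim: d n => [|d IHd] n leNn.
    rewrite addn0 modn_small ?ltnS ?x_le // => xn; exists n => // n' /subnKC <-.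
    suff -> : x (n + (n' - n)) = j by apply: wF; rewrite (leq_trans leNn) ?leq_addr.
    elim: (n' - n) => [|e IHe]; first by rewrite addn0.
    have leNe : N <= n + e by rewrite (leq_trans leNn) ?leq_addr.
    by rewrite addnS x_stay // IHe wF.
  move=> xnd; have [stay|] := EM (forall n', n <= n' -> w n' \in F p (x n')).
    by exists n.
  move=> moves; have ex_move : exists i, w (n + i) \notin F p (x (n + i)).
    have [n' /not_implyP[lenn' /negP out]] := (existsNP _).2 moves.
    by exists (n' - n); rewrite subnKC.
  case: (ex_minnP ex_move) => i out i_min.
  have leNi : N <= n + i by rewrite (leq_trans leNn) ?leq_addr.
  have xi : forall e, e <= i -> x (n + e) = x n.
    elim=> [|e IHe] lei; first by rewrite addn0.
    rewrite addnS x_stay ?IHe ?(ltnW lei) // ?(leq_trans leNn) ?leq_addr //.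
    by rewrite -(IHe (ltnW lei)); apply: contraLR lei => /i_min; rewrite -leqNgt.
  apply: (IHd (n + i).+1); first exact: leqW.
  by rewrite x_move // xi // modnDml addSnnS.
(* One full turn is added so that the distance to [j] is not a truncated subtraction. *)
apply: (cycle ((m p).+1 - x N + j) N) => //.
have xN := x_le N (leqnn N).
by rewrite addnA subnKC ?modnDl ?modn_small // leqW.
Qed.

End RoundRobin.

(** * A deterministic automaton for the words of color at least [i] *)

Section ColorAutomaton.
Variables (k i : nat).
Hypotheses (k_gt1 : 1 < k) (i_gt0 : 0 < i).
Local Notation A := (alphabet k).
Implicit Types (u v : seq A) (w : word A) (S : {set A}) (p q : parities k).

Let k_gt0 : 0 < k := ltnW k_gt1.

(* There is one interval per X-level. If X_1 is even then level 0 is void and level 1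
   only carries color 1, so it is skipped for [1 < i]. *)
Definition xlevel p (j : nat) : nat :=
  if bit false p 1 then j else j + minn i 2.

Definition last_interval p : nat := if bit false p 1 then k else k - 2.

(** The condition on X bounds the index of the letter from above, the one on Y from below. It is
    tested letter by letter, so that the automaton can check it. *)
Definition interval p j : {set A} :=
  [set c | [&& isA c, xlevel p j <= lev false p [set c] &
    i <= rk (~~ bit false p 1) (~~ bit true p 1) (xlevel p j) (lev true p [set c])]].

Lemma xlevel_valid p j c : isA c ->
  valid_levels (~~ bit false p 1) (~~ bit true p 1) (xlevel p j) (lev true p [set c]).
Proof.
move=> cA; rewrite /valid_levels /xlevel; apply/andP; split; apply/implyP => p1.
  by rewrite (negbTE p1); case: i i_gt0 => [//|[|n _]]; rewrite ?addn1 ?addn2.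
by apply: lev_gt0 => //; apply/subsetP => d /set1P->.
Qed.

(** Some letter attains the Y-level of [S], and all letters respect the X-level of the interval, so
    monotonicity of [rk] bounds the rank. Conversely, take the interval given by the X-level of
    [S]. *)
Lemma intervals_cover p S : S != set0 ->
  (exists2 j, j <= last_interval p & S \subset interval p j) <-> i <= rank p S.
Proof.
move=> S_neq0; split=> [[j _ /subsetP S_int]|lei].
  have [c cS lec] := lev_attained true p S_neq0.
  have := S_int c cS; rewrite inE => /and3P[cA le_c rk_c].
  have SA : S \subset @isA k by apply/subsetP => d /S_int; rewrite inE => /andP[].
  apply: leq_trans rk_c _; apply: rk_mono lec; first exact: xlevel_valid.
  case: (posnP (xlevel p j)) => [->//|x_gt0].
  have xk : 0 < xlevel p j <= k by rewrite x_gt0 (leq_trans le_c) ?lev_le.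
  rewrite levP //; apply/subsetP => d /S_int; rewrite inE => /and3P[_ le_d _].
  by move: le_d; rewrite levP // => /subsetP; apply; apply: set11.
have SA : S \subset @isA k.
  by apply: contraTT lei => S_notA; rewrite rank_notA // -ltnNge.
have [j lej xj] : exists2 j, j <= last_interval p & xlevel p j <= lev false p S /\
    i <= rk (~~ bit false p 1) (~~ bit true p 1) (xlevel p j) (lev true p S).
  rewrite /last_interval /xlevel; move: lei; rewrite /rank.
  have := lev_le false p S; have := lev_gt0 (b := false) k_gt0 SA (p := p).
  case: (boolP (bit false p 1)) => [_ _ lexk lei|p1 /(_ isT) x_gt0 lexk lei].
    by exists (lev false p S).
  case: (eqVneq i 1) => [i1|i_neq1].
    by exists 0 => //; rewrite i1; split=> //; rewrite /rk.
  have i_gt1 : 1 < i by rewrite ltn_neqAle eq_sym i_neq1.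
  (* With [X_1] even, X-level 1 would give rank 1, which is below [i]. *)
  have x_gt1 : 1 < lev false p S.
    rewrite ltn_neqAle x_gt0 andbT; apply/eqP => x1; move: lei.
    by rewrite /rk -x1 /= leqNgt i_gt1.
  exists (lev false p S - 2); first exact: leq_sub2r.
  by rewrite (minn_idPr i_gt1) subnK.
exists j => //; apply/subsetP => c cS; have [lex le_rk] := xj.
have cA : isA c by move/subsetP: SA; apply.
have sub_c : [set c] \subset S by rewrite sub1set.
rewrite inE cA (leq_trans lex) ?lev_anti //= (leq_trans le_rk) //.
apply: rk_mono; rewrite ?lev_anti //; have := xlevel_valid p j cA.
case/andP=> vx _; rewrite /valid_levels vx; apply/implyP; exact: lev_gt0.
Qed.

Definition par_step p (c : A) : parities k := padd p (par [:: c]).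

Lemma foldl_par_step u : foldl par_step (par [::]) u = par u.
Proof. by elim/last_ind: u => // u c IHu; rewrite foldl_rcons IHu -cats1 par_cat. Qed.

Lemma interval_par_step p j c : c \in interval p j -> par_step p c = p.
Proof.
rewrite inE => /andP[cA _]; rewrite /par_step (_ : par _ = [ffun=> false]) ?padd0 //.
by apply/ffunP => d; rewrite !ffunE; case: c cA.
Qed.

Definition color_automaton : cobuchi A :=
  round_robin par_step (par [::]) last_interval interval.

Lemma color_automaton_accepted w p S N : tail_class w p S N ->
  accepted color_automaton w <-> i <= rank p S.
Proof.
move=> clw; have [wS _ wp] := clw.
have S_neq0 : S != set0 by apply/set0Pn; exists (w N); apply: wS.
rewrite -(intervals_cover p S_neq0) (round_robin_accepted _ _ interval_par_step).
split=> [[N' [p' [j [lej modeN' w_int]]]]|[j lej /subsetP S_int]].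
  have sub : S \subset interval p' j.
    by apply/subsetP => s; case: clw => _ Sinf _ /Sinf/(_ N')[n leN'n <-]; apply: w_int.
  have wA n : N' <= n -> isA (w n) by move/w_int; rewrite inE => /andP[].
  have SA : S \subset @isA k.
    by apply/subsetP => s /(subsetP sub); rewrite inE => /andP[].
  suff <- : p' = p by exists j.
  rewrite -modeN' foldl_par_step -(par_prefix_stable wA (leq_maxr N N')).
  exact: par_stable SA clw (leq_maxl _ _).
exists N, p, j; split=> // [|n /wS/S_int//].
by rewrite foldl_par_step.
Qed.

End ColorAutomaton.

(** Flipping the parity of [X_1] pairs a mode with [k + 1] intervals and one with [k - 1], so twice
    the sum is [2 * k] per mode. *)
Lemma sum_last_interval k : 1 < k ->
  \sum_(p : parities k) (last_interval p).+1 = 2 ^ (2 * k) * k.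
Proof.
move=> k_gt1; have k_gt0 := ltnW k_gt1.
pose e : parities k := [ffun c => c == side false (Ordinal k_gt0)].
pose h p := padd p e; have hK : involutive h.
  by move=> p; apply/ffunP => c; rewrite !ffunE addbK.
apply/eqP; rewrite -(eqn_pmul2l (isT : 0 < 2)) mul2n -addnn; apply/eqP.
rewrite {1}(reindex_inj (inv_inj hK)) -big_split /=.
rewrite (eq_bigr (fun=> 2 * k)) => [|p _].
  rewrite sum_nat_const card_ffun card_bool card_sum card_ord addnn -mul2n; lia.
rewrite /last_interval (bitE false _ (Ordinal k_gt0)) (bitE false p (Ordinal k_gt0)).
by rewrite !ffunE eqxx; case: (p _) => /=; lia.
Qed.

Lemma minimal_deterministic_exists (A : finType) (L : olang A) D :
  deterministic D -> oeq (accepted D) L -> exists D', minimal_deterministic L D'.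
Proof.
pose Q n := exists D', [/\ deterministic D', oeq (accepted D') L & nb_states D' = n].
move=> detD DL; have exQ : exists n, `[< Q n >].
  by exists (nb_states D); apply/asboolP; exists D.
case: (ex_minnP exQ) => n /asboolP[D' [detD' D'L <-]] n_min.
by exists D'; split=> // D2 det2 D2L; apply: n_min; apply/asboolP; exists D2.
Qed.

(** Read [v] along the advice, then continue from the common state with the run advised after [u];
    finitely many initial colors do not affect acceptance. *)
Lemma advice_residual (A : finType) (B : cobuchi A) (f : seq A -> state B) u v :
  f [::] = init B ->
  (forall u x, exists c, delta (f u) x (f (rcons u x)) c) ->
  (forall w, accepted B w ->
     exists2 c, is_run w (fun n => f (prefix_of w n)) c & accepting_colors c) ->
  f u = f v -> osubset (residual (accepted B) u) (residual (accepted B) v).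
Proof.
move=> f0 f_step f_acc fuv w /f_acc[c [_ run] c_acc].
have [d dP] := choice (fun n => f_step (prefix_of (wcat v w) n) (wcat v w n)).
pose r n := if n <= size v then f (prefix_of (wcat v w) n)
            else f (u ++ prefix_of w (n - size v)).
pose c' n := if n < size v then d n else c (size u + (n - size v)).
have rE n : r (size v + n) = f (u ++ prefix_of w n).
  rewrite /r; case: n => [|n]; last first.
    by rewrite -[X in _ <= X]addn0 leq_add2l addKn.
  by have := prefix_wcat v w 0; rewrite addn0 leqnn => ->; rewrite !cats0.
have run' : is_run (wcat v w) r c'.
  split=> // n; case: (ltnP n (size v)) => [ltn|/subnKC <-].
    by have := dP n; rewrite -prefix_ofS /r /c' ltn (ltnW ltn).
  move: (n - size v) => {}n; have := run (size u + n).
  rewrite -!addnS !rE !wcat_ge !prefix_wcat /c'.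
  by rewrite ltnNge leq_addr /= addKn.
exists r, c'; split=> //; have c12 n : (c n == 1) || (c n == 2) := delta_color (run n).
have c'12 n : (c' n == 1) || (c' n == 2) := delta_color (run'.2 n).
have [N cN] := (accepting_colorsP c12).1 c_acc.
apply/accepting_colorsP => //; exists (size v + N) => n leNn.
have lev : size v <= n by apply: leq_trans leNn; apply: leq_addr.
rewrite /c' ltnNge lev /= cN // (leq_trans _ (leq_addl _ _)) //.
by rewrite leq_subRL.
Qed.

(** * The lower bound *)

(* In the words that separate the residuals, [X_1] and [Y_1] are kept odd, so that
   the levels start from 0 in both chains. *)
Lemma cocoa_lower_bound k (C : nat -> cobuchi (alphabet k)) : 1 < k ->
  is_cocoa (target_olang k) (2 * k) C -> 2 ^ (2 * k./2) <= nb_states (C (2 * k./2)).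
Proof.
move=> k_gt1 cocoaC; set h := k./2; have k_gt0 := ltnW k_gt1.
have leh : 2 * h <= k by have := odd_double_half k; rewrite -/h; lia.
have le2h : 2 * h <= 2 * k by apply: leq_trans leh _; apply: leq_pmull.
have [->|h_neq0] := eqVneq h 0; first by apply/card_gt0P; exists (init (C 0)).
have [f [f0 f_step f_acc]] : history_deterministic (C (2 * h)).
  by case: cocoaC => _ HD _ _; apply: HD; rewrite le2h andbT; lia.
(* Ordinals count from 0: value 0 stands for [X_1] or [Y_1], and bit [l] is stored at value
   [2l + 1], that is, at the letter of even index [2l + 2]. *)
pose val (beta : {ffun 'I_h + 'I_h -> bool}) b (j : 'I_k) : bool :=
  (j == 0 :> nat) || odd j && oapp (fun l => beta (side b l)) false (insub j./2).
pose p_ beta : parities k :=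
  [ffun c => match c with inl j => val beta false j | inr j => val beta true j end].
have p_side beta b j : p_ beta (side b j) = val beta b j.
  by rewrite ffunE; case: b.
have [u_ uP] := choice (fun beta => par_surj (p_ beta)).
suff inj : injective (fun beta => f (u_ beta)).
  have := leq_card _ inj.
  by rewrite card_ffun card_bool card_sum card_ord addnn -mul2n.
move=> beta beta' fE; apply/ffunP => c.
have [b [l ->]] : exists b l, c = side b l.
  by case: c => l; [exists false, l | exists true, l].
have ltj : (l.*2).+1 < k by have := ltn_ord l; lia.
pose j := Ordinal ltj.
(* The other chain is held at the even level [2h - 2l - 2], so the rank is [2h] if the bit is false
   and [2h - 1] if it is true. *)
have [s [t [sA tA stP]]] := probe b j (leq_trans (leq_subr l.+1.*2 (2 * h)) leh).
have val_j gamma : p_ gamma (side b j) = gamma (side b l).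
  rewrite p_side /val /= odd_double /= uphalf_double.
  by rewrite valK.
have acc gamma :
    accepted (C (2 * h)) (wcat (u_ gamma) (alternate s t)) <-> ~~ gamma (side b l).
  have cl := tail_class_wcat (u_ gamma) (alternate_class s t).
  rewrite (cocoa_accepted k_gt1 cocoaC le2h cl) padd0 uP /rank.
  have bit1 b' : bit b' (p_ gamma) 1 by rewrite (bitE b' _ (Ordinal k_gt0)) p_side.
  rewrite !bit1; have [|] := stP (p_ gamma); first by rewrite bit1.
  rewrite val_j => lev1 lev2.
  have -> : rk (~~ true) (~~ true) (lev false (p_ gamma) [set s; t])
                (lev true (p_ gamma) [set s; t]) =
            j + ~~ gamma (side b l) + (2 * h - l.+1.*2).
    have odd_z : odd (2 * h - l.+1.*2) = false by have := ltn_ord l; lia.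
    case: (b) lev1 lev2 => /= -> ->; rewrite /rk /= odd_z ?andbF ?andFb !subn0 //.
    exact: addnC.
  by have := ltn_ord l; rewrite /=; case: (gamma _) => /=; split; lia.
have sub x y : f x = f y -> osubset (residual (accepted (C (2 * h))) x)
    (residual (accepted (C (2 * h))) y) := advice_residual f0 f_step f_acc.
have s1 := sub _ _ fE (alternate s t); have s2 := sub _ _ (esym fE) (alternate s t).
apply: negb_inj; apply/idP/idP; rewrite -!acc; first exact: s1.
exact: s2.
Qed.

Theorem proposition5p12 (k : nat) (C : nat -> cobuchi (alphabet k)) :
  is_cocoa (target_olang k) (2 * k) C ->
  [/\ k <> 1 -> forall i, 1 <= i <= 2 * k ->
        (exists D, minimal_deterministic (accepted (C i)) D) /\
        (forall D, minimal_deterministic (accepted (C i)) D ->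
           nb_states D <= 2 ^ (2 * k) * k),
      ~~ odd k -> 2 ^ k <= nb_states (C k)
    & odd k ->
        ((2%:R : rat) ^ (k%:Z - 2%:Z) <= (nb_states (C k.-1))%:R)%R].
Proof.
move=> cocoaC.
have nb_gt0 n : 0 < nb_states (C n) by apply/card_gt0P; exists (init (C n)).
split=> [k_neq1 i /andP[i_gt0 lei]|evk|oddk].
(* The index [i] between 1 and [2 * k] excludes [k = 0]. *)
- have k_gt1 : 1 < k by lia.
  have detD : deterministic (color_automaton k i) by apply: round_robin_deterministic.
  have D_C : oeq (accepted (color_automaton k i)) (accepted (C i)).
    move=> w; have [p [S [N clw]]] := tail_class_exists w.
    rewrite (color_automaton_accepted k_gt1 i_gt0 clw).
    by rewrite (cocoa_accepted k_gt1 cocoaC lei clw).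
  split=> [|D [_ _ min]]; first exact: minimal_deterministic_exists detD D_C.
  apply: leq_trans (min _ detD D_C) _.
  by rewrite nb_states_round_robin sum_last_interval.
- have [|k_le1] := ltnP 1 k; last first.
    by have k0 : k = 0 by [lia]; rewrite [X in 2 ^ X]k0.
  by move/cocoa_lower_bound/(_ cocoaC); rewrite mul2n even_halfK.
(* For odd [k], [2 * k./2] is [k - 1]; for [k = 1] the bound only says that a state exists. *)
have lb : 2 ^ k.-1 <= nb_states (C k.-1).
  have [|k_le1] := ltnP 1 k; last first.
    by have k1 : k.-1 = 0 by [lia]; rewrite [X in 2 ^ X]k1.
  by move/cocoa_lower_bound/(_ cocoaC); rewrite mul2n odd_halfK.
(* The comparison is made in the rationals, as the exponent [k - 2] is negative for [k = 1]. *)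
apply: (@Order.POrderTheory.le_trans _ _ ((2 ^ k.-1)%:R)%R); last first.
  by rewrite Num.Theory.ler_nat.
rewrite GRing.natrX exprnP; apply: ler_weXz2l => //.
by lia.
Qed.
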